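(* Let $\ell$ and $m$ be positive integers such that $2 \leq \ell < m$. Let $\mathcal{A} = (A_1, \ldots, A_m)$ be a sequence of finite subsets of $\mathbb{Z}_p$, where $p$ is prime and $|A_i| \geq 2$ for each $i \in [1, m]$. Let $A = A_1 \cup \cdots \cup A_m$, for $a\in A$ let $\mu(a) = \min\big(\ell, \sum_{j=1}^m \chi_{A_j}(a)\big)$ (where $\chi_{A_j}(a)=1$ if $a\in A_j$ and $0$ otherwise), and let $M = \{a \in A: \mu(a) = \ell\}$. Suppose \[ |\Sigma^{\ell}(\mathcal{A})| < \begin{cases} p - 1, & \text{if } \ell = 2; \\ p, & \text{if } \ell \geq 3. \end{cases} \] Then \[ |\Sigma^{\ell}(\mathcal{A})| = \sum_{a \in A} \mu (a) - \ell + 1 \] if and only if $\mathcal{A}$ is an $(\ell, d)$-minimizing sequence of sets for some $d$. Furthermore, if both the strict upper bound on $|\Sigma^{\ell}(\mathcal{A})|$ and this equality hold, then: (1) if $\ell = 2$, the sets $A_1 \cup M, \ldots, A_m \cup M$ are arithmetic progressions; (2) if $\ell \geq 3$, the sets $A, A_1 \cup M, \ldots, A_m \cup M$ are arithmetic progressions with the same common difference $d$; (3) if $\ell \geq 3$, the set $A$ is also an arithmetic progression with common difference $d$.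
   Context: $\mathbb{Z}_p$ is written additively. $\Sigma^{\ell}(\mathcal{A})$ is the set of all sums $a_{i_1} + \cdots + a_{i_{\ell}}$ with $a_{i_j} \in A_{i_j}$ and $1 \leq i_1 < \cdots < i_{\ell} \leq m$. The sequence $\mathcal{A}$ is an $(\ell, d)$-minimizing sequence of sets if there exist sets $B_1, \ldots, B_{\ell} \subseteq A$ such that: (i) $|B_i| \geq 2$ for all $i$; (ii) there is $d \neq 0$ such that each $B_i$ is an arithmetic progression with common difference $d$; (iii) $\mu(a) = \sum_{j=1}^{\ell} \chi_{B_j}(a)$ for every $a \in A$; (iv) $B_1 + \cdots + B_{\ell} = \Sigma^{\ell}(\mathcal{A})$. *)

(* Defs.v *)
(* Z_p is 'Z_p with p prime (so p >= 2). *)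
From mathcomp Require Import all_boot all_order all_algebra.
Set Implicit Arguments. Unset Strict Implicit. Unset Printing Implicit Defensive.
Import GRing.Theory.
Local Open Scope ring_scope.

(* B is an arithmetic progression with common difference d:
   B = {b, b+d, ..., b+(k-1)d} for some b, k. (d <> 0 is required separately.) *)
Definition is_AP (p : nat) (B : {set 'Z_p}) (d : 'Z_p) : Prop :=
  exists (b : 'Z_p) (k : nat), B = [set b + d *+ (val i) | i : 'I_k].

Definition Aunion (p m : nat) (A : 'I_m -> {set 'Z_p}) : {set 'Z_p} :=
  \bigcup_(i < m) A i.

(* Sigma^l(A): all sums a_{i_1}+...+a_{i_l}, i_1<...<i_l, a_{i_j} in A_{i_j};
   indexed here by the l-element index set I = {i_1,...,i_l}. *)
Definition Sigma (p m : nat) (l : nat) (A : 'I_m -> {set 'Z_p}) : {set 'Z_p} :=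
  [set x | [exists I : {set 'I_m}, [exists f : {ffun 'I_m -> 'Z_p},
      [&& #|I| == l, [forall i in I, f i \in A i] & x == \sum_(i in I) f i]]]].

Definition mu (p m : nat) (l : nat) (A : 'I_m -> {set 'Z_p}) (a : 'Z_p) : nat :=
  minn l #|[set j : 'I_m | a \in A j]|.

Definition Mset (p m : nat) (l : nat) (A : 'I_m -> {set 'Z_p}) : {set 'Z_p} :=
  [set a in Aunion A | mu l A a == l].

Definition sumset (p l : nat) (B : 'I_l -> {set 'Z_p}) : {set 'Z_p} :=
  [set x | [exists f : {ffun 'I_l -> 'Z_p},
      [forall j, f j \in B j] && (x == \sum_(j < l) f j)]].

Definition minimizing (p m : nat) (l : nat) (A : 'I_m -> {set 'Z_p}) (d : 'Z_p)
  : Prop :=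
  exists B : 'I_l -> {set 'Z_p},
    [/\ (forall j, B j \subset Aunion A),
        (forall j, (2 <= #|B j|)%N),
        d != 0 /\ (forall j, is_AP (B j) d),
        (forall a, a \in Aunion A -> mu l A a = #|[set j : 'I_l | a \in B j]|)
      & sumset B = Sigma l A].

(* Main.v *)
Require Import Defs.
From HB Require Import structures.
From mathcomp Require Import all_boot all_order all_algebra all_fingroup zify.
Set Implicit Arguments. Unset Strict Implicit. Unset Printing Implicit Defensive.
Import GRing.Theory.
Local Open Scope ring_scope.

(** Peel the sets off one at a time: if a part [A_1 :|: M] is formed from the
    first set and the elements lying in at least [l] sets, and the remaining
    [l - 1] parts are built in the same way from [A_2, ..., A_m], then the parts
    have the multiplicities [mu] and their sumset lies in [Sigma l A], since an
    element of [M] outside [A_1] always finds an unused set containing it.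
    Cauchy-Davenport bounds the sumset of the parts from below, so in the
    extremal case Vosper's theorem makes all parts progressions with one common
    difference. Any [A_i] may be put first; if [l >= 3], exchanging the first two
    sets leaves the third part unchanged, so the difference does not depend on
    [i]. Replacing [A_i, A_j] by [A_i :|: A_j, A_i :&: A_j] keeps the family
    extremal, so [A_i :|: A_j :|: M] is a progression as well, and the union of
    all sets is a union of progressions through a common point.

    In a cyclic group of prime order, progressions with difference [d <> 0] are
    the sets with at most one exit, i.e. at most one [x] with [x + d] outside. *)

(** * Sumsets in groups of prime order *)

Section Sumsets.
Variable G : finZmodType.
Implicit Types (A B C D : {set G}) (d : G).

Definition addS A B : {set G} := [set a + b | a in A, b in B].

Lemma mem_addS A B a b : a \in A -> b \in B -> a + b \in addS A B.
Proof. exact: imset2_f. Qed.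

Lemma addSSS A B C D : A \subset C -> B \subset D -> addS A B \subset addS C D.
Proof.
move=> /subsetP AC /subsetP BD; apply/subsetP => _ /imset2P[a b aA bB ->].
by apply: mem_addS; [apply: AC | apply: BD].
Qed.

Lemma addSC : commutative addS.
Proof.
move=> A B; apply/setP => x.
by apply/imset2P/imset2P => -[a b aA bB ->]; exists b a; rewrite // addrC.
Qed.

Lemma addSA : associative addS.
Proof.
move=> A B C; apply/setP => x; apply/imset2P/imset2P.
  case=> a _ aA /imset2P[b c bB cC ->] ->.
  by exists (a + b) c; rewrite ?mem_addS ?addrA.
case=> _ c /imset2P[a b aA bB ->] cC ->.
by exists a (b + c); rewrite ?mem_addS ?addrA.
Qed.

Lemma add0S : left_id [set 0] addS.
Proof.
move=> A; apply/setP => x; apply/imset2P/idP => [[_ a /set1P-> aA ->]|xA].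
  by rewrite add0r.
by exists 0 x; rewrite ?set11 ?add0r.
Qed.

HB.instance Definition _ := Monoid.isComLaw.Build {set G} [set 0] addS addSA addSC add0S.

Lemma card_translate A t : #|[set x + t | x in A]| = #|A|.
Proof. by apply: card_imset => x y /addIr. Qed.

Lemma card_addS1 A b : #|addS A [set b]| = #|A|.
Proof.
rewrite -(card_translate A b); apply: eq_card => x.
apply/imset2P/imsetP => [[a _ aA /set1P-> ->]|[a aA ->]]; first by exists a.
by exists a b; rewrite ?set11.
Qed.

Lemma leq_card_addS A B : B != set0 -> (#|A| <= #|addS A B|)%N.
Proof.
case/set0Pn => b bB; rewrite -(card_addS1 A b).
by apply/subset_leq_card/addSSS; rewrite ?sub1set.
Qed.

Lemma addS_neq0 A B : A != set0 -> B != set0 -> addS A B != set0.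
Proof. by case/set0Pn=> a aA /set0Pn[b bB]; apply/set0Pn; exists (a + b); apply: mem_addS. Qed.

Definition exits d B : {set G} := [set x in B | x + d \notin B].

Definition is_arc d B := (#|exits d B| <= 1)%N.

Lemma card_exitsC d B : #|exits d (~: B)| = #|exits d B|.
Proof.
pose D : {set G} := [set x | x + d \in B].
have cD : #|D| = #|B|.
  rewrite -(card_translate B (- d)); apply: eq_card => x; rewrite inE.
  apply/idP/imsetP => [xB|[y yB ->]]; last by rewrite subrK.
  by exists (x + d); rewrite ?addrK.
have -> : exits d B = B :\: D by apply/setP => x; rewrite !inE andbC.
have -> : exits d (~: B) = D :\: B by apply/setP => x; rewrite !inE negbK.
have := cardsID B D; have := cardsID D B; rewrite (setIC D); lia.
Qed.

Lemma arcC d B : is_arc d (~: B) = is_arc d B.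
Proof. by rewrite /is_arc card_exitsC. Qed.

Lemma arcN d B : is_arc (- d) B = is_arc d B.
Proof.
rewrite -(arcC d) /is_arc -(card_translate (exits d (~: B)) d); congr (_ <= _)%N.
apply: eq_card => x; rewrite !inE; apply/andP/imsetP => [[xB xdB]|[y]].
  by exists (x - d); rewrite ?subrK // !inE subrK xB xdB.
by rewrite !inE negbK => /andP[yB ydB] ->; rewrite addrK ydB.
Qed.

Lemma arc_opp d B : is_arc d [set - b | b in B] = is_arc d B.
Proof.
rewrite -(arcN d B) /is_arc -(card_imset (exits (- d) B) (@oppr_inj G)); congr (_ <= _)%N.
have mN y : (y \in [set - b | b in B]) = (- y \in B).
  by rewrite -{1}[y]opprK mem_imset //; apply: oppr_inj.
apply: eq_card => x; rewrite inE !mN opprD.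
apply/idP/imsetP => [xB|[y]]; first by exists (- x); rewrite ?opprK // inE.
by rewrite inE => yB ->; rewrite opprK.
Qed.

Lemma card_add_pair d B : d != 0 -> #|addS [set 0; d] B| = (#|B| + #|exits d B|)%N.
Proof.
move=> d0; rewrite -(card_translate (exits d B) d).
have -> : addS [set 0; d] B = B :|: [set x + d | x in exits d B].
  apply/setP => x; rewrite inE; apply/imset2P/orP.
    case=> e b /set2P[]-> bB ->; first by left; rewrite add0r.
    case bdB: (b + d \in B); first by left; rewrite addrC.
    by right; rewrite addrC; apply/imsetP; exists b; rewrite // inE bB bdB.
  case=> [xB|/imsetP[y]]; first by exists 0 x; rewrite ?set21 ?add0r.
  by rewrite inE => /andP[yB _] ->; exists d y; rewrite ?set22 // addrC.
rewrite cardsU; set I := _ :&: _; suff -> : I = set0 by rewrite cards0 subn0.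
apply/setP => x; rewrite !inE; apply/negP => /andP[xB /imsetP[y]].
by rewrite inE => /andP[_ yB] xE; rewrite -xE xB in yB.
Qed.

Lemma arc_addS d A B : is_arc d A -> is_arc d B -> is_arc d (addS A B).
Proof.
move=> /card_le1_eqP aA /card_le1_eqP aB; apply/card_le1_eqP.
have exE s : s \in exits d (addS A B) ->
    exists a b, [/\ a \in exits d A, b \in exits d B & s = a + b].
  rewrite inE => /andP[/imset2P[a b aA' bB ->] sd]; exists a, b.
  rewrite !inE aA' bB /=; split=> //; apply: contra sd => h.
    by rewrite addrAC mem_addS.
  by rewrite -addrA mem_addS.
move=> _ _ /exE[a [b [ea eb ->]]] /exE[a' [b' [ea' eb' ->]]].
by rewrite (aA a a') // (aB b b').
Qed.

Section PrimeOrder.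
Hypothesis G_prime : prime #|G|.

Lemma invariant_setT d C x :
  d != 0 -> x \in C -> (forall y, y \in C -> y + d \in C) -> C = setT.
Proof.
move=> d0 xC Cd; apply/setP => y; rewrite inE.
have /cycleP[i yx] : y - x \in <[d]>%g.
  suff -> : <[d]>%g = [set: G] by rewrite inE.
  apply/eqP; rewrite eqEcard subsetT cardsT /=.
  have := cardSg (subsetT <[d]>%G); rewrite /= cardsT.
  case/primeP: G_prime => _ dv /dv /orP[|/eqP<-] //.
  by rewrite order_eq1 => /eqP de; case/eqP: d0.
have -> : y = x + d *+ i by rewrite -FinRing.zmodXgE -yx addrC subrK.
by elim: i {yx} => [|i IH]; rewrite ?addr0 // mulrSr addrA Cd.
Qed.

Lemma exits_neq0 d C : d != 0 -> C != set0 -> C != setT -> exits d C != set0.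
Proof.
move=> d0 /set0Pn[x xC]; apply: contraNneq => e0; apply/eqP.
apply: (invariant_setT d0 xC) => y yC; apply/negPn/negP => ydC.
by move/setP/(_ y): e0; rewrite !inE yC ydC.
Qed.

Lemma card_lt_neqT A : (#|A| < #|G|)%N -> A != setT.
Proof. by apply: contraTneq => ->; rewrite cardsT ltnn. Qed.

(* The e-transform: [A :|: (B + e)] and [B :&: (A - e)]. *)
Definition etop A B e : {set G} := A :|: [set b + e | b in B].
Definition ebot A B e : {set G} := [set b in B | b + e \in A].

Lemma card_etransform A B e : (#|etop A B e| + #|ebot A B e| = #|A| + #|B|)%N.
Proof.
rewrite -(card_translate (ebot A B e) e) -(card_translate B e).
suff -> : [set x + e | x in ebot A B e] = A :&: [set b + e | b in B].
  by rewrite cardsUI.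
apply/setP => x; rewrite inE; apply/imsetP/andP => [[y]|[xA /imsetP[y yB xE]]].
  by rewrite inE => /andP[yB yA] ->; split=> //; apply/imsetP; exists y.
by exists y; rewrite // inE yB -xE.
Qed.

Lemma addS_etransform A B e : addS (etop A B e) (ebot A B e) \subset addS A B.
Proof.
apply/subsetP => _ /imset2P[x y + + ->]; rewrite !inE => + /andP[yB yA].
case/orP => [xA|/imsetP[b bB ->]]; first exact: mem_addS.
by rewrite -addrA addrC [e + y]addrC mem_addS.
Qed.

Lemma cauchy_davenport A B : A != set0 -> B != set0 ->
  (#|addS A B| < #|G|)%N -> (#|A| + #|B| <= #|addS A B|.+1)%N.
Proof.
have [n] := ubnP #|B|; elim: n A B => // n IH A B Bn A0 B0 AB.
have [/eqP/cards1P[b ->]|B1] := eqVneq #|B| 1%N; first by rewrite card_addS1 cards1 addn1.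
have /card_gt1P[b1 [b2 [b1B b2B b12]]] : (1 < #|B|)%N.
  by rewrite ltn_neqAle eq_sym B1 card_gt0.
have AT : A != setT by apply/card_lt_neqT/(leq_ltn_trans _ AB)/leq_card_addS.
have := exits_neq0 _ A0 AT; move/(_ (b2 - b1)); rewrite subr_eq0 eq_sym => /(_ b12).
case/set0Pn => a; rewrite inE => /andP[aA adA].
pose e := a - b1.
have b1e : b1 \in ebot A B e by rewrite inE b1B /e addrC subrK.
have b2e : b2 \notin ebot A B e by rewrite inE b2B /e addrCA.
have sE := subset_leq_card (addS_etransform A B e).
rewrite -(card_etransform A B e); apply: leq_trans (_ : _ <= #|addS (etop A B e) (ebot A B e)|.+1)%N _ => //.
apply: IH.
- apply: leq_trans (_ : #|B| <= n)%N; last by [].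
  apply/proper_card/properP; split; last by exists b2.
  by apply/subsetP => x; rewrite inE => /andP[].
- by apply/set0Pn; exists a; rewrite inE aA.
- by apply/set0Pn; exists b1.
exact: leq_ltn_trans AB.
Qed.

Lemma arc_of_summand d A B : d != 0 -> is_arc d A -> (1 < #|A|)%N -> B != set0 ->
  (#|addS A B| < #|G|)%N -> (#|addS A B| < #|A| + #|B|)%N -> is_arc d B.
Proof.
move=> d0 aA A1 B0 ABG AB.
pose A' := A :\: exits d A.
have A'c : (#|A| <= #|A'|.+1)%N.
  have := cardsID (exits d A) A; rewrite -/A'.
  have := subset_leq_card (subsetIr A (exits d A)); rewrite /is_arc in aA; lia.
have sub : addS A' (addS [set 0; d] B) \subset addS A B.
  rewrite addSA; apply: addSSS => //; apply/subsetP => _ /imset2P[a e + /set2P[]-> ->].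
    by rewrite inE addr0 => /andP[].
  by rewrite !inE negb_and negbK => /andP[/orP[/negP|//] aN /aN].
have := @cauchy_davenport A' (addS [set 0; d] B).
have -> : A' != set0 by rewrite -card_gt0; lia.
have -> : addS [set 0; d] B != set0.
  by apply: addS_neq0 => //; apply/set0Pn; exists 0; rewrite set21.
have := subset_leq_card sub; rewrite card_add_pair // /is_arc; lia.
Qed.

Lemma arc_uniq d d' A : d != 0 -> d' != 0 -> is_arc d A -> is_arc d' A ->
  (1 < #|A|)%N -> (#|A| + 1 < #|G|)%N -> d' = d \/ d' = - d.
Proof.
move=> d0 d'0 aA; rewrite {1}/is_arc => aA' A1 AG.
have c2 : #|[set 0; d']| = 2%N by rewrite cards2 eq_sym d'0.
have /card_le1_eqP a2 : is_arc d [set 0; d'].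
  apply: (arc_of_summand d0 aA) => //.
  - by rewrite -card_gt0 c2.
  - by rewrite addSC card_add_pair //; lia.
  - by rewrite addSC card_add_pair // c2; lia.
case: (boolP (d \in [set 0; d'])) => [|dn].
  by rewrite !inE (negPf d0) /= => /eqP ->; left.
case: (boolP (d' + d \in [set 0; d'])) => [|d'n].
  rewrite !inE => /orP[|]; first by rewrite addr_eq0 => /eqP; right.
  by rewrite -subr_eq0 addrC addKr (negPf d0).
suff /eqP : 0 = d' by rewrite eq_sym (negPf d'0).
by apply: a2; rewrite inE ?set21 ?set22 ?add0r.
Qed.

(* Duality: with [C] the complement of [A + B], [C - B] is the complement of [A]. *)
Lemma arc_of_arc_addS d A B : d != 0 -> is_arc d (addS A B) -> A != set0 -> B != set0 ->
  (#|addS A B| + 1 < #|G|)%N -> (#|addS A B| < #|A| + #|B|)%N -> is_arc d B.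
Proof.
move=> d0 aAB A0 B0 ABG AB; rewrite -arc_opp.
pose C := ~: addS A B.
have cC : (#|addS A B| + #|C| = #|G|)%N := cardsC (addS A B).
have cA : (#|A| + #|~: A| = #|G|)%N := cardsC A.
have cN : #|[set - b | b in B]| = #|B| by apply: card_imset; apply: oppr_inj.
have sub : addS C [set - b | b in B] \subset ~: A.
  apply/subsetP => _ /imset2P[c _ + /imsetP[b bB ->] ->]; rewrite !inE.
  by apply: contra => cA'; rewrite -(subrK b c) mem_addS.
have := subset_leq_card sub.
move: A0; rewrite -card_gt0 => A0 le.
apply: (@arc_of_summand d C) => //.
- by rewrite arcC.
- by lia.
- by rewrite -card_gt0 cN card_gt0.
- by lia.
- by rewrite cN; lia.
Qed.

Lemma vosper A B : (1 < #|A|)%N -> (1 < #|B|)%N ->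
  (#|addS A B| + 1 < #|G|)%N -> (#|addS A B| < #|A| + #|B|)%N ->
  exists2 d : G, d != 0 & is_arc d A /\ is_arc d B.
Proof.
have [n] := ubnP #|B|; elim: n A B => // n IH A B Bn A1 B1 ABG AB.
have A0 : A != set0 by rewrite -card_gt0; lia.
have B0 : B != set0 by rewrite -card_gt0; lia.
suff [d d0 aAB] : exists2 d : G, d != 0 & is_arc d (addS A B).
  exists d => //; split; last exact: arc_of_arc_addS aAB _ _ _ _.
  by rewrite addSC in aAB ABG AB; apply: arc_of_arc_addS aAB _ _ _ _; rewrite // addnC.
have [B2|B2] := leqP #|B| 2.
  have /cards2P[b [b' [bb' BE]]] : #|B| == 2%N by rewrite eqn_leq B2.
  exists (b' - b); first by rewrite subr_eq0 eq_sym.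
  have aB : is_arc (b' - b) B.
    apply/card_le1_eqP => x y; rewrite BE !inE.
    have h z : (z == b) || (z == b') -> ~~ ((z + (b' - b) == b) || (z + (b' - b) == b')) -> z = b'.
      by case/orP => /eqP -> //; rewrite addrC subrK eqxx orbT.
    by move=> /andP[/h hx /hx ->] /andP[/h hy /hy ->].
  apply: arc_addS => //; apply: (@arc_of_summand _ B) => //.
  - by rewrite subr_eq0 eq_sym.
  - by rewrite addSC; lia.
  - by rewrite addSC; lia.
suff [e e1 e2] : exists2 e, (1 < #|ebot A B e|)%N & ~~ (B \subset ebot A B e).
  have sE := addS_etransform A B e; have cE := card_etransform A B e.
  have eB : (#|ebot A B e| < #|B|)%N.
    apply/proper_card/properP; split.
      by apply/subsetP => x; rewrite inE => /andP[].
    by case/subsetPn: e2 => x; exists x.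
  have sEc := subset_leq_card sE.
  have eA := subset_leq_card (subsetUl A [set b + e | b in B]); rewrite -/(etop A B e) in eA.
  have cd := @cauchy_davenport (etop A B e) (ebot A B e).
  have eq : addS (etop A B e) (ebot A B e) = addS A B.
    apply/eqP; rewrite eqEcard sE; rewrite -!card_gt0 in cd; lia.
  have [|||||d d0 [a1 a2]] := IH (etop A B e) (ebot A B e); rewrite ?eq; try lia.
  by exists d => //; rewrite -eq; apply: arc_addS.
case/set0Pn: B0 => b bB.
(* Otherwise any a in A not in X satisfies (a - b + B) :&: A = {a}. *)
case: (boolP [exists a in A, (1 < #|ebot A B (a - b)|)%N && ~~ (B \subset ebot A B (a - b))]).
  by case/exists_inP => a _ /andP[]; exists (a - b).
rewrite negb_exists_in => /forall_inP noe; exfalso.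
pose X := [set a in A | B \subset ebot A B (a - b)]; pose Y := A :\: X.
have cA := cardsID X A; rewrite -/Y in cA.
have XA : A :&: X = X by apply/setIidPr/subsetP => x; rewrite inE => /andP[].
rewrite XA in cA.
have Y1 : (#|Y| <= 1)%N.
  pose YB := addS Y [set c - b | c in B :\ b].
  have [->|Y0] := eqVneq Y set0; first by rewrite cards0.
  have cBb : #|[set c - b | c in B :\ b]| = #|B|.-1 by rewrite card_translate (cardsD1 b B) bB.
  have disj : [disjoint A & YB].
    rewrite disjoint_sym disjoint_subset; apply/subsetP => _ /imset2P[y _ yY /imsetP[c cB ->] ->].
    move: yY cB; rewrite !inE => /andP[+ yA] /andP[cb cB]; rewrite yA /= => nsub.
    have := noe y yA; rewrite nsub andbT -leqNgt => /card_le1_eqP h.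
    apply: contra cb => ycA; apply/eqP/h; rewrite inE ?cB ?bB /= addrC ?subrK //.
    by rewrite -addrA [- b + c]addrC.
  have sub : A :|: YB \subset addS A [set c - b | c in B].
    rewrite subUset; apply/andP; split.
      apply/subsetP => a aA; apply/imset2P; exists a 0; rewrite ?addr0 //.
      by apply/imsetP; exists b; rewrite ?subrr.
    by apply: addSSS; [apply: subsetDl | apply/imsetS/subsetDl].
  have cAB : #|addS A [set c - b | c in B]| = #|addS A B|.
    rewrite -(card_translate (addS A B) (- b)); apply: eq_card => x.
    apply/imset2P/imsetP => [[a _ aA /imsetP[c cB ->] ->]|[_ /imset2P[a c aA cB ->] ->]].
      by exists (a + c); rewrite ?mem_addS ?addrA.
    by exists a (c - b); rewrite ?addrA //; apply/imsetP; exists c.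
  have := subset_leq_card sub; rewrite cardsU disjoint_setI0 // cards0 subn0 cAB.
  have := @cauchy_davenport Y [set c - b | c in B :\ b] Y0.
  rewrite -card_gt0 cBb -/YB; lia.
have X0 : X != set0 by rewrite -card_gt0; lia.
have sub : addS X [set c - b | c in B] \subset A.
  apply/subsetP => _ /imset2P[x _ + /imsetP[c cB ->] ->]; rewrite inE => /andP[_ /subsetP/(_ _ cB)].
  by rewrite inE => /andP[_]; rewrite addrCA addrA addrC addrA.
have := @cauchy_davenport X [set c - b | c in B] X0.
have lAB : (#|A| <= #|addS A B|)%N by apply: leq_card_addS; apply/set0Pn; exists b.
rewrite -card_gt0 card_translate; have := subset_leq_card sub; lia.
Qed.

End PrimeOrder.
End Sumsets.

(* [simpl] first: the same cardinal may occur with syntactically different,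
   convertible canonical instances, which [lia] takes for distinct atoms. *)
Ltac card_lia := simpl in *; lia.

Section PrimeOrderArcs.
Variable G : finZmodType.
Hypothesis G_prime : prime #|G|.
Implicit Types (A B C : {set G}) (d : G).

Lemma arc_transfer d d' A B : d != 0 -> d' != 0 -> is_arc d A -> is_arc d' A ->
  (1 < #|A|)%N -> (#|A| + 1 < #|G|)%N -> is_arc d' B -> is_arc d B.
Proof.
move=> d0 d'0 aA aA' A1 AG.
by case: (arc_uniq G_prime d0 d'0 aA aA' A1 AG) => ->; rewrite ?arcN.
Qed.

Lemma card_addS_arc d A B : d != 0 -> is_arc d A -> is_arc d B ->
  A != set0 -> B != set0 -> (#|addS A B| < #|A| + #|B|)%N.
Proof.
move=> d0 aA aB; have [n] := ubnP #|A|; elim: n A aA => // n IH A aA An A0 B0.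
have [/eqP/cards1P[a ->]|A1] := eqVneq #|A| 1%N; first by rewrite addSC card_addS1 cards1.
have Bp : (0 < #|B|)%N by rewrite card_gt0.
have lG C : (#|C| <= #|G|)%N by apply: max_card.
have [->|AT] := eqVneq A setT.
  by have := lG (addS setT B); rewrite (cardsT G : #|[set: G]| = #|G|); lia.
case/set0Pn: (exits_neq0 G_prime d0 A0 AT) => u uE.
have /andP[uA uN] : (u \in A) && (u + d \notin A) by move: uE; rewrite inE.
have uniq x : x \in A -> x + d \notin A -> x = u.
  by move=> xA xN; apply: (card_le1_eqP aA); rewrite // inE xA xN.
have cA := cardsD1 u A; rewrite uA add1n in cA.
have A10 : A :\ u != set0 by rewrite -card_gt0 -ltnS -cA ltn_neqAle eq_sym A1 card_gt0.
have A1T : A :\ u != setT by apply/eqP => /setP/(_ u); rewrite !inE eqxx.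
have preu x : x \in exits d (A :\ u) -> x + d = u.
  rewrite !inE negb_and negbK => /andP[/andP[xu xA] /orP[/eqP //|/(uniq x xA) xE]].
  by rewrite xE eqxx in xu.
have [v vE] := set0Pn _ (exits_neq0 G_prime d0 A10 A1T).
have vA : v \in A :\ u by move: vE; rewrite inE => /andP[].
have sub : addS A B \subset addS (A :\ u) B :|: [set u + b | b in exits d B].
  apply/subsetP => _ /imset2P[a b aA' bB ->]; rewrite inE.
  case: (eqVneq a u) => [->|au]; last by rewrite mem_addS // !inE au.
  case: (boolP (b + d \in B)) => [bdB|bN].
    have -> : u + b = v + (b + d) by rewrite -(preu v vE) [b + d]addrC addrA.
    by rewrite mem_addS.
  by apply/orP; right; apply: imset_f; rewrite inE bB bN.
have aA1 : is_arc d (A :\ u).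
  by apply/card_le1_eqP => x y /preu xu /preu yu; apply: (addIr d); rewrite xu.
have cAB : (#|addS A B| <= #|addS (A :\ u) B| + 1)%N.
  apply: leq_trans (subset_leq_card sub) _; apply: leq_trans (leq_card_setU _ _) _.
  by rewrite leq_add2l; apply: leq_trans (leq_imset_card _ _) _.
have An1 : (#|A :\ u| < n)%N by rewrite cA in An.
have := IH (A :\ u) aA1 An1 A10 B0; clear -cA cAB; lia.
Qed.

(* The number of exits is submodular, and a nonempty intersection has an exit
   unless it is everything. *)
Lemma arcU d A B x : d != 0 -> is_arc d A -> is_arc d B -> x \in A -> x \in B ->
  is_arc d (A :|: B).
Proof.
move=> d0 aA aB xA xB.
have [IT|IT] := eqVneq (A :&: B) setT.
  have -> : A :|: B = setT.
    by apply/eqP; rewrite -subTset -IT subIset // subsetUl.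
  by rewrite -arcC setCT /is_arc (_ : exits d set0 = set0) ?cards0 //; apply/setP => y; rewrite !inE.
have I0 : A :&: B != set0 by apply/set0Pn; exists x; rewrite inE xA.
have := exits_neq0 G_prime d0 I0 IT; rewrite -card_gt0.
have := cardsUI (exits d A) (exits d B).
have := cardsUI (exits d (A :|: B)) (exits d (A :&: B)).
have : (#|exits d (A :|: B) :|: exits d (A :&: B)| <= #|exits d A :|: exits d B|)%N.
  apply/subset_leq_card/subsetP => y; rewrite !inE.
  by do 4!case: (_ \in _).
have : (#|exits d (A :|: B) :&: exits d (A :&: B)| <= #|exits d A :&: exits d B|)%N.
  apply/subset_leq_card/subsetP => y; rewrite !inE.
  by do 4!case: (_ \in _).
rewrite /is_arc in aA aB *; lia.
Qed.

Definition total_card (s : seq {set G}) : nat := \sum_(B <- s) #|B|.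

Lemma total_card_cons B s : total_card (B :: s) = (#|B| + total_card s)%N.
Proof. exact: big_cons. Qed.

Lemma perm_total_card s t : perm_eq s t -> total_card s = total_card t.
Proof. exact: perm_big. Qed.

Definition sumS (s : seq {set G}) : {set G} := \big[@addS G/[set 0]]_(B <- s) B.

Lemma sumS_cons B s : sumS (B :: s) = addS B (sumS s).
Proof. exact: big_cons. Qed.

Lemma perm_sumS s t : perm_eq s t -> sumS s = sumS t.
Proof. exact: perm_big. Qed.

Lemma sumS_neq0 s : all (fun B => B != set0) s -> sumS s != set0.
Proof.
elim: s => [|B s IH] /=; first by rewrite /sumS big_nil -card_gt0 cards1.
by case/andP=> B0 /IH s0; rewrite sumS_cons addS_neq0.
Qed.

Lemma cauchy_davenport_seq s : all (fun B => B != set0) s -> (#|sumS s| < #|G|)%N ->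
  (total_card s + 1 <= #|sumS s| + size s)%N.
Proof.
elim: s => [|B s IH] /=; first by rewrite /sumS /total_card !big_nil cards1.
case/andP=> B0 s0; rewrite sumS_cons total_card_cons => lt.
have := cauchy_davenport G_prime B0 (sumS_neq0 s0) lt.
have := leq_card_addS (sumS s) B0; rewrite addSC => le.
have := IH s0 (leq_ltn_trans le lt); card_lia.
Qed.

Lemma arc_sumS d s : d != 0 -> all (fun B => B != set0) s -> all (is_arc d) s ->
  is_arc d (sumS s) /\ (#|sumS s| + size s <= total_card s + 1)%N.
Proof.
move=> d0; elim: s => [|B s IH] /=.
  move=> _ _; rewrite /sumS /total_card !big_nil cards1; split=> //.
  rewrite /is_arc -(cards1 (0 : G)).
  by apply/subset_leq_card/subsetP => x /setIdP[].
case/andP=> B0 s0 /andP[aB as_]; have [aS cS] := IH s0 as_.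
rewrite sumS_cons total_card_cons; split; first exact: arc_addS.
have := card_addS_arc d0 aB aS B0 (sumS_neq0 s0); card_lia.
Qed.

Lemma all_big_neq0 (s : seq {set G}) :
  all (fun B => 1 < #|B|)%N s -> all (fun B => B != set0) s.
Proof. by apply: sub_all => B B1; rewrite -card_gt0 (ltn_trans _ B1). Qed.

Lemma vosper_seq s : (1 < size s)%N -> all (fun B => 1 < #|B|)%N s ->
  (#|sumS s| + (size s == 2%N) < #|G|)%N ->
  (#|sumS s| + size s <= total_card s + 1)%N ->
  exists2 d : G, d != 0 & forall B, B \in s -> is_arc d B /\ (#|B| + 1 < #|G|)%N.
Proof.
move=> s1 sB sG sE.
have pair X Z t : perm_eq s [:: X, Z & t] ->
    [/\ 1 < #|X|, 1 < #|Z|, #|addS X Z| + 1 < #|G| & #|addS X Z| < #|X| + #|Z|]%N.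
  move=> st; rewrite (perm_sumS st) (perm_size st) (perm_total_card st) in sG sE.
  rewrite !sumS_cons addSA !total_card_cons in sG sE.
  move: sB; rewrite (perm_all _ st) /= => /and3P[X1 Z1 tB].
  have t0 := sumS_neq0 (all_big_neq0 tB).
  have XZ0 : addS X Z != set0 by apply: addS_neq0; rewrite -card_gt0 ltnW.
  have le := leq_card_addS (addS X Z) t0.
  split=> //.
    case: t {st} tB sG t0 {sE le} => [|W t] /= tB sG t0.
      by move: sG; rewrite /sumS big_nil addSC add0S.
    have [W1 tB'] := andP tB.
    have := leq_card_addS W (sumS_neq0 (all_big_neq0 tB')); rewrite -sumS_cons.
    have := cauchy_davenport G_prime XZ0 t0; clear -sG W1; card_lia.
  have sG' : (#|addS (addS X Z) (sumS t)| < #|G|)%N by apply: leq_ltn_trans sG; apply: leq_addr.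
  have := cauchy_davenport G_prime XZ0 t0 sG'.
  have := cauchy_davenport_seq (all_big_neq0 tB).
  have := leq_card_addS (sumS t) XZ0; rewrite addSC; clear -sG' sE; card_lia.
case: s s1 pair {sG sE sB} => [|X [|Y t]] //= _ pair.
have [X1 Y1 XYG XY] := pair X Y t (perm_refl _).
have [d d0 [aX aY]] := vosper G_prime X1 Y1 XYG XY.
exists d => // B; rewrite inE => /orP[/eqP->|].
  split=> //; have := @leq_card_addS G X Y; rewrite -card_gt0; card_lia.
move=> Bt; have st : perm_eq [:: X, Y & t] [:: X, B & rem B (Y :: t)].
  by rewrite perm_cons perm_to_rem.
have [_ B1 XBG XB] := pair X B _ st.
have lB := @leq_card_addS G B X; rewrite addSC -card_gt0 in lB.
split; last by card_lia.
by apply: (arc_of_summand G_prime d0 aX) => //; rewrite -?card_gt0; card_lia.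
Qed.

End PrimeOrderArcs.

(** * Set partitions of a sequence of sets *)

Section Systems.
Variable G : finZmodType.
Implicit Types (X Y T : {set G}) (s t r : seq {set G}).

Fixpoint Sig l s {struct s} : {set G} :=
  match s, l with
  | [::], 0 => [set 0]
  | [::], _.+1 => set0
  | X :: s', 0 => [set 0]
  | X :: s', l'.+1 => addS X (Sig l' s') :|: Sig l s'
  end.

Lemma Sig0 s : Sig 0 s = [set 0].
Proof. by case: s. Qed.

Lemma addSUr X Y T : addS X (Y :|: T) = addS X Y :|: addS X T.
Proof.
apply/setP => x; rewrite inE; apply/imset2P/orP.
  by case=> a b aX /setUP[bY|bT] ->; [left | right]; apply: mem_addS.
by case=> /imset2P[a b aX bY ->]; exists a b; rewrite // inE bY ?orbT.
Qed.

Lemma addSUl X Y T : addS (Y :|: T) X = addS Y X :|: addS T X.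
Proof. by rewrite ![addS _ X]addSC addSUr. Qed.

Lemma Sig_cons2 X Y s l : Sig l.+2 [:: X, Y & s] =
  addS (addS X Y) (Sig l s) :|: addS (X :|: Y) (Sig l.+1 s) :|: Sig l.+2 s.
Proof. by rewrite /= addSUr addSUl addSA !setUA. Qed.

Lemma Sig1_cons2 X Y s : Sig 1 [:: X, Y & s] = X :|: Y :|: Sig 1 s.
Proof. by rewrite /= !Sig0 ![addS _ [set 0]]addSC !add0S setUA. Qed.

Lemma Sig_swap X Y s l : Sig l [:: X, Y & s] = Sig l [:: Y, X & s].
Proof.
case: l => [|[|l]]; rewrite ?Sig0 // ?Sig1_cons2 ?Sig_cons2.
  by rewrite (setUC X).
by rewrite (setUC X) (addSC X).
Qed.

Lemma Sig_congr_cons X s t : (forall l, Sig l s = Sig l t) ->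
  forall l, Sig l (X :: s) = Sig l (X :: t).
Proof. by move=> st [|l] /=; rewrite ?st. Qed.

Lemma perm_Sig s t l : perm_eq s t -> Sig l s = Sig l t.
Proof.
elim: s t l => [|X s IH] t l; first by move/perm_size/esym/size0nil ->.
move=> st; have /splitPr tE : X \in t by rewrite -(perm_mem st) mem_head.
case: tE st => t1 t2; rewrite perm_sym perm_catC cat_cons perm_cons perm_catC perm_sym => /IH {}IH.
rewrite (@Sig_congr_cons X s (t1 ++ t2)) //; elim: t1 l {IH} => [|Y t1 IH] l //.
by rewrite !cat_cons Sig_swap; apply: Sig_congr_cons.
Qed.

Lemma Sig_uncross X Y s l :
  Sig l (X :|: Y :: rcons s (X :&: Y)) \subset Sig l [:: X, Y & s].
Proof.
have st : perm_eq (X :|: Y :: rcons s (X :&: Y)) [:: X :|: Y, X :&: Y & s].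
  by rewrite perm_cons perm_rcons.
rewrite (perm_Sig l st); case: l {st} => [|[|l]]; rewrite ?Sig0 // ?Sig1_cons2 ?Sig_cons2.
  by apply: setSU; rewrite subUset subxx subIset // subsetUl.
apply: setSU; apply: setUSS; apply: addSSS => //.
  apply/subsetP => _ /imset2P[x y + /setIP[yX yY] ->].
  by case/setUP => xX; [|rewrite addrC]; apply: mem_addS.
by rewrite subUset subxx subIset // subsetUl.
Qed.

Definition deg s (a : G) := count (fun X : {set G} => a \in X) s.

Definition frequent l s : {set G} := [set a | l <= deg s a]%N.

Lemma perm_deg s t : perm_eq s t -> deg s =1 deg t.
Proof. by move=> /seq.permP st a; apply: st. Qed.

Lemma deg_uncross X Y s : deg (X :|: Y :: rcons s (X :&: Y)) =1 deg [:: X, Y & s].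
Proof.
move=> a; rewrite /deg /= -cats1 count_cat /= !inE.
by case: (a \in X); case: (a \in Y) => /=; lia.
Qed.

Lemma eq_frequent l s t : deg s =1 deg t -> frequent l s = frequent l t.
Proof. by move=> st; apply/setP => a; rewrite !inE st. Qed.

(* An element lying in more than l of the sets is always left with an unused one. *)
Lemma add_frequent_Sig l s x y : (l < deg s x)%N -> y \in Sig l s -> x + y \in Sig l.+1 s.
Proof.
elim: s l y => [|X s IH] l y //; rewrite [deg _ _]/= => dx.
rewrite [Sig l.+1 _]/= inE => yS.
have [xX|xX] := boolP (x \in X); last first.
  rewrite (negPf xX) add0n in dx; case: l dx yS => [|l] dx /=.
    by move=> y0; rewrite IH ?orbT // Sig0.
  rewrite inE => /orP[/imset2P[u v uX vS ->]|yS]; last by rewrite [_ \in Sig _ s]IH ?orbT.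
  by rewrite addrCA mem_addS //= IH // ltnW.
case: l dx yS => [|l] dx /=; first by rewrite !Sig0 => y0; rewrite mem_addS.
rewrite xX add1n ltnS in dx.
rewrite inE => /orP[/imset2P[u v uX vS ->]|yS]; last by rewrite mem_addS.
by rewrite addrCA mem_addS //= IH.
Qed.

(* Greedy set partition: each part absorbs the elements that are frequent enough
   to lose one occurrence without lowering their capped multiplicity. *)
Fixpoint parts l s {struct s} : seq {set G} :=
  match s, l with
  | X :: s', l'.+1 => X :|: frequent l s :: parts l' s'
  | _, _ => [::]
  end.

Lemma size_parts l s : (l <= size s)%N -> size (parts l s) = l.
Proof. by elim: s l => [|X s IH] [|l] //= /IH ->. Qed.

Lemma deg_parts l s a : (l <= size s)%N -> deg (parts l s) a = minn l (deg s a).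
Proof.
elim: s l => [|X s IH] [|l] ls; rewrite /deg //= ?min0n //.
rewrite -!/(deg _ _) IH // !inE /=; rewrite -!/(deg _ _).
by case: (a \in X) => /=; case: leqP; lia.
Qed.

Lemma parts_big l s : all (fun X => 1 < #|X|)%N (take l s) ->
  all (fun X => 1 < #|X|)%N (parts l s).
Proof.
elim: s l => [|X s IH] [|l] //= /andP[X1 /IH ->]; rewrite andbT.
exact/(leq_trans X1)/subset_leq_card/subsetUl.
Qed.

Lemma sumS_parts l s : (l <= size s)%N -> sumS (parts l s) \subset Sig l s.
Proof.
elim: s l => [|X s IH] [|l] //= ls; try by rewrite /sumS big_nil.
rewrite sumS_cons; apply/subsetP => _ /imset2P[x y xX /(subsetP (IH _ ls)) yS ->].
rewrite inE; have [x'X|x'X] := boolP (x \in X); first by rewrite mem_addS.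
move: xX; rewrite !inE /= (negPf x'X) add0n -/(deg s x) => xd.
by rewrite add_frequent_Sig ?orbT.
Qed.

Lemma sum_card_deg s : (total_card s = \sum_a deg s a)%N.
Proof.
rewrite /total_card /deg; under [RHS]eq_bigr do rewrite -sum1_count big_mkcond /=.
rewrite exchange_big /=; apply: eq_bigr => X _.
by rewrite -sum1_card big_mkcond.
Qed.

Hypothesis G_prime : prime #|G|.

Definition extremal l T s :=
  [/\ (1 < l <= size s)%N, Sig l s \subset T, (#|T| + (l == 2%N) < #|G|)%N
    & (#|T| + l <= \sum_a minn l (deg s a) + 1)%N].

Lemma extremal_perm l T s t : perm_eq s t -> extremal l T s -> extremal l T t.
Proof.
move=> st [ls sT TG Tc]; split; rewrite -?(perm_size st) -?(perm_Sig l st) //.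
by under eq_bigr do rewrite -(perm_deg st).
Qed.

Lemma extremal_uncross l T X Y s :
  extremal l T [:: X, Y & s] -> extremal l T (X :|: Y :: rcons s (X :&: Y)).
Proof.
move=> [ls sT TG Tc]; split=> //; first by rewrite /= size_rcons.
  exact: subset_trans (Sig_uncross _ _ _ _) sT.
by under eq_bigr do rewrite deg_uncross.
Qed.

Lemma extremal_parts l T s : extremal l T s -> all (fun X => 1 < #|X|)%N (take l s) ->
  sumS (parts l s) = T /\
  exists2 d : G, d != 0 & forall B, B \in parts l s -> is_arc d B /\ (#|B| + 1 < #|G|)%N.
Proof.
case=> /andP[l1 ls] sT TG Tc /parts_big big.
have sub := subset_trans (sumS_parts ls) sT; have le := subset_leq_card sub.
have cP : (total_card (parts l s) = \sum_a minn l (deg s a))%N.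
  by rewrite sum_card_deg; apply: eq_bigr => a _; rewrite deg_parts.
have cd := cauchy_davenport_seq G_prime (all_big_neq0 big).
have sP := size_parts ls; rewrite sP cP in cd.
split; first by apply/eqP; rewrite eqEcard sub; lia.
by apply: vosper_seq; rewrite ?sP ?cP //; lia.
Qed.

(* Exchanging the first two sets does not change the third part, which fixes the
   common difference. *)
Lemma extremal_heads l T X Y s : (2 < l)%N -> extremal l T [:: X, Y & s] ->
  all (fun X => 1 < #|X|)%N (take l [:: X, Y & s]) ->
  exists2 d : G, d != 0 &
    [/\ forall B, B \in parts l [:: X, Y & s] -> is_arc d B,
        is_arc d (X :|: frequent l [:: X, Y & s]), is_arc d (Y :|: frequent l [:: X, Y & s]),
        (#|X :|: frequent l [:: X, Y & s]| + 1 < #|G|)%N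
      & (#|Y :|: frequent l [:: X, Y & s]| + 1 < #|G|)%N].
Proof.
case: l => [|[|[|l]]] // _ ex big.
have sw : perm_eq [:: X, Y & s] [:: Y, X & s] by apply/permEl/(perm_catCA [:: X] [:: Y]).
have ex' := extremal_perm sw ex.
have big' : all (fun X => 1 < #|X|)%N (take l.+3 [:: Y, X & s]).
  by move: big; rewrite /= andbCA.
have [_ [d d0 arcs]] := extremal_parts ex big.
have [_ [d' d'0 arcs']] := extremal_parts ex' big'.
have fr := eq_frequent l.+3 (perm_deg sw).
case: s {sw} ex ex' big big' arcs arcs' fr => [|Z s]; first by case=> /andP[].
move=> _ _ /and4P[X1 Y1 Z1 _] _ arcs arcs' fr.
pose third := Z :|: frequent l.+1 (Z :: s).
have inP U V : third \in parts l.+3 [:: U, V, Z & s] by rewrite !inE eqxx !orbT.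
have [a3 G3] := arcs _ (inP X Y); have [a3' _] := arcs' _ (inP Y X).
have third1 : (1 < #|third|)%N by apply/(leq_trans Z1)/subset_leq_card/subsetUl.
have [aX GX] := arcs _ (mem_head _ _); have [aY GY] := arcs' _ (mem_head _ _).
rewrite -!fr in aY GY.
exists d => //; split=> //; first by move=> B /arcs[].
exact: (arc_transfer G_prime d0 d'0 a3 a3').
Qed.

End Systems.

(** * Families of subsets of Z_p *)

Section IndexedFamilies.
Variables (G : finZmodType) (I : finType) (A : I -> {set G}).

Lemma mem_sumS (r : seq I) (x : G) : uniq r ->
  reflect (exists2 f : I -> G, (forall j, j \in r -> f j \in A j) & x = \sum_(j <- r) f j)
          (x \in sumS [seq A j | j <- r]).
Proof.
move=> r_uniq; apply: (iffP idP).
  elim: r r_uniq x => [|i r IH] /= => [_|/andP[ir /IH {}IH]] x.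
    by rewrite /sumS big_nil => /set1P ->; exists (fun _ => 0); rewrite ?big_nil.
  rewrite sumS_cons => /imset2P[a y aA /IH[f fA ->] ->].
  have fE j : j \in r -> (if j == i then a else f j) = f j.
    by case: eqP => // -> ri; rewrite ri in ir.
  exists (fun j => if j == i then a else f j).
    move=> j; rewrite inE; case: eqP => [-> //|_]; exact: fA.
  by rewrite big_cons eqxx; congr (_ + _); apply: eq_big_seq => j /fE.
case=> f fA ->; elim: r {r_uniq} fA => [|i r IH] fA.
  by rewrite /sumS !big_nil set11.
rewrite big_cons sumS_cons mem_addS ?fA ?mem_head //.
by apply: IH => j jr; apply: fA; rewrite inE jr orbT.
Qed.

Lemma mem_Sig (r : seq I) l (x : G) : uniq r ->
  reflect (exists J : {set I}, exists f : I -> G,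
    [/\ {subset J <= r}, #|J| = l, forall i, i \in J -> f i \in A i & x = \sum_(i in J) f i])
    (x \in Sig l [seq A i | i <- r]).
Proof.
move=> r_uniq; apply: (iffP idP).
  elim: r r_uniq l x => [|i r IH] /= => [_|/andP[ir /IH {}IH]] [|l] x; rewrite ?inE //.
  - by move/eqP=> ->; exists set0, (fun _ => 0); rewrite cards0 big_set0; split=> // j; rewrite inE.
  - by move/eqP=> ->; exists set0, (fun _ => 0); rewrite cards0 big_set0; split=> // j; rewrite inE.
  case/orP => [/imset2P[a y aA /IH[J [f [Jr Jl fA ->]]] ->]|/IH[J [f [Jr Jl fA ->]]]]; last first.
    exists J, f; split=> //; move=> j /Jr jr.
    by rewrite inE jr orbT.
  have iJ : i \notin J by apply: contra ir => /Jr.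
  have fE j : j \in J -> (if j == i then a else f j) = f j.
    by case: eqP => // -> ri; rewrite ri in iJ.
  exists (i |: J), (fun j => if j == i then a else f j); split.
  - move=> j; rewrite !inE => /orP[->//|/Jr jr].
    by rewrite jr orbT.
  - by rewrite cardsU1 iJ Jl.
  - by move=> j; rewrite !inE; case: eqP => [-> //|_]; apply: fA.
  - by rewrite big_setU1 //= eqxx; congr (_ + _); apply: eq_bigr => j /fE.
elim: r r_uniq l x => [|i r IH] => [_|/andP[ir /IH {}IH]] l x [J [f [Jr Jl fA ->]]].
  have J0 : J = set0 by apply/setP => j; rewrite inE; apply/negP => /Jr.
  by rewrite -Jl J0 cards0 big_set0 inE.
have [iJ|iJ] := boolP (i \in J); last first.
  have Jr' : {subset J <= r}.
    move=> j jJ; have := Jr j jJ; rewrite inE.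
    by case/orP=> // /eqP ji; rewrite -ji jJ in iJ.
  have xS : \sum_(j in J) f j \in Sig l [seq A k | k <- r] by apply: IH; exists J, f.
  by case: l Jl xS => [|l] _ /=; rewrite ?Sig0 // !inE => ->; rewrite orbT.
rewrite (cardsD1 i) iJ add1n in Jl; case: l Jl => // l [Jl].
rewrite (big_setD1 i iJ) /= inE mem_addS ?fA //; apply: IH; exists (J :\ i), f; split=> //.
  move=> j; rewrite !inE => /andP[ji /Jr].
  by rewrite inE (negPf ji).
by move=> j; rewrite inE => /andP[_ /fA].
Qed.

Lemma deg_enum a : deg [seq A i | i <- enum I] a = #|[set i | a \in A i]|.
Proof. by rewrite /deg count_map -size_filter cardsE cardE enumT. Qed.

End IndexedFamilies.

Lemma perm_two_heads (T : eqType) (s : seq T) (x y : T) :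
  x \in s -> y \in s -> y != x -> perm_eq s [:: x, y & rem y (rem x s)].
Proof.
move=> xs ys yx; apply: perm_trans (perm_to_rem xs) _; rewrite perm_cons perm_to_rem //.
by have := perm_mem (perm_to_rem xs) y; rewrite inE (negPf yx) ys.
Qed.

Section Multiples.
Variables (p : nat) (p_prime : prime p).

Lemma card_Zp_prime : #|'Z_p| = p.
Proof. by rewrite card_ord Zp_cast // prime_gt1. Qed.

Lemma prime_card_Zp : prime #|('Z_p : finZmodType)|.
Proof. by rewrite card_Zp_prime. Qed.

Lemma is_AP_arc (B : {set 'Z_p}) d : is_AP B d -> is_arc d B.
Proof.
case=> b [k BE]; apply/card_le1_eqP.
have h x : x \in exits d B -> x = b + d *+ k.-1.
  case/setIdP => xB; move: xB; rewrite BE => /imsetP[i _ ->].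
  have ik := ltn_ord i; have [ik'|ik' _] := ltnP i.+1 k; last first.
    by congr (_ + _ *+ _); rewrite -[val i]/(nat_of_ord i); lia.
  by case/negP; apply/imsetP; exists (Ordinal ik'); rewrite //= mulrSr addrA.
by move=> x y /h -> /h ->.
Qed.

Lemma mulrn_surj (d y : 'Z_p) : d != 0 -> exists2 i, (i < p)%N & y = d *+ i.
Proof.
move=> d0; pose C := [set x : 'Z_p | [exists i : 'I_p, x == d *+ i]].
have dp : d *+ p = 0 by rewrite -mulr_natr pchar_Zp ?mulr0 // prime_gt1.
have p0 := prime_gt0 p_prime.
have CT : C = setT.
  apply: (@invariant_setT _ prime_card_Zp d C 0) => //.
    by rewrite inE; apply/existsP; exists (Ordinal p0).
  move=> x; rewrite !inE => /existsP[i /eqP ->]; rewrite -mulrSr; apply/existsP.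
  have [ip|ip] := ltnP i.+1 p; first by exists (Ordinal ip).
  exists (Ordinal p0); have -> : i.+1 = p by apply/eqP; rewrite eqn_leq ltn_ord.
  by rewrite dp.
by have := in_setT y; rewrite -CT inE => /existsP[i /eqP ->]; exists i.
Qed.

Lemma arc_is_AP (B : {set 'Z_p}) d : d != 0 -> is_arc d B -> is_AP B d.
Proof.
move=> d0 aB.
have [->|B0] := eqVneq B set0.
  by exists 0, 0%N; apply/setP => x; rewrite inE; apply/esym/imsetP => -[[]].
have [->|BT] := eqVneq B setT.
  exists 0, p; apply/setP => x; rewrite inE; apply/esym/imsetP.
  by have [i ip ->] := mulrn_surj x d0; exists (Ordinal ip); rewrite ?add0r.
have Nd0 : - d != 0 by rewrite oppr_eq0.
have [b /setIdP[bB bN]] := set0Pn _ (exits_neq0 prime_card_Zp Nd0 B0 BT).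
have ex : exists k, b + d *+ k \notin B.
  have [y yB] : exists y, y \notin B.
    by move: BT; rewrite -subTset => /subsetPn[y _ yB]; exists y.
  have [i _ yi] := mulrn_surj (y - b) d0; exists i.
  by rewrite -yi addrC subrK.
case: (ex_minnP ex) => k kB kmin; exists b, k.
have inB i : (i < k)%N -> b + d *+ i \in B.
  by move=> ik; apply/negPn/negP => /kmin; rewrite leqNgt ik.
set R := [set _ | _ in _].
have inR i : (i < k)%N -> b + d *+ i \in R by move=> ik; apply/imsetP; exists (Ordinal ik).
have k0 : (0 < k)%N by case: k kB {kmin inB R inR} => //; rewrite addr0 bB.
have lastB : b + d *+ k.-1 \in exits d B.
  by rewrite inE inB ?prednK //= -addrA -mulrSr prednK.
apply/eqP; rewrite eqEsubset; apply/andP; split; last first.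
  by apply/subsetP => _ /imsetP[i _ ->]; exact: inB (ltn_ord i).
rewrite -setD_eq0; apply/eqP/setP => x; rewrite [RHS]inE; apply/negP => xD.
have DT : B :\: R = setT.
  apply: (invariant_setT prime_card_Zp d0 xD) => y /setDP[yB yR].
  have ydB : y + d \in B.
    apply: contraNT yR => ydB; rewrite (card_le1_eqP aB (b + d *+ k.-1) y) ?inR ?prednK //.
    by rewrite inE yB ydB.
  rewrite inE ydB andbT; apply: contra yR => /imsetP[[[|i] ik] _ /= E].
    by case/negP: bN; rewrite -[b]addr0 -[0](mulr0n d) -E addrK.
  have -> : y = b + d *+ i by apply: (addIr d); rewrite E mulrSr addrA.
  exact/inR/ltnW.
by have := in_setT b; rewrite -DT inE -[b](addr0) -[0](mulr0n d) inR.
Qed.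

End Multiples.

Section Family.
Variables (p l m : nat) (A : 'I_m -> {set 'Z_p}).
Hypothesis p_prime : prime p.

Let Gp := prime_card_Zp p_prime.

Definition family : seq {set 'Z_p} := [seq A i | i <- enum 'I_m].

Lemma size_family : size family = m.
Proof. by rewrite size_map size_enum_ord. Qed.

Lemma sumset_sumS (B : 'I_l -> {set 'Z_p}) : sumset B = sumS [seq B j | j <- enum 'I_l].
Proof.
apply/setP => x; rewrite inE; apply/existsP/(mem_sumS _ _ (enum_uniq _)).
  by case=> f /andP[/forallP fB /eqP ->]; exists f; rewrite ?big_enum.
case=> f fB ->; exists [ffun j => f j]; apply/andP; split.
  by apply/forallP => j; rewrite ffunE fB ?mem_enum.
by apply/eqP; rewrite big_enum /=; apply: eq_bigr => j _; rewrite ffunE.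
Qed.

Lemma Sigma_Sig : Sigma l A = Sig l family.
Proof.
apply/setP => x; rewrite inE; apply/existsP/(mem_Sig _ _ _ (enum_uniq _)).
  case=> J /existsP[f /and3P[/eqP Jl /forall_inP fA /eqP ->]].
  by exists J, f; split=> // j; rewrite mem_enum.
case=> J [f [_ Jl fA ->]]; exists J; apply/existsP; exists [ffun j => f j]; apply/and3P.
split; first exact/eqP.
  by apply/forall_inP => j jJ; rewrite ffunE fA.
by apply/eqP/eq_bigr => j _; rewrite ffunE.
Qed.

Lemma mu_deg a : mu l A a = minn l (deg family a).
Proof. by rewrite /mu /family deg_enum. Qed.

Lemma mem_Aunion a : (a \in Aunion A) = (0 < deg family a)%N.
Proof.
rewrite /family deg_enum card_gt0; apply/bigcupP/set0Pn => [[i _ ai]|[i]].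
  by exists i; rewrite inE.
by rewrite inE; exists i.
Qed.

Lemma sum_mu : (\sum_(a in Aunion A) mu l A a = \sum_a minn l (deg family a))%N.
Proof.
rewrite big_mkcond; apply: eq_bigr => a _; rewrite mu_deg mem_Aunion.
by case: (deg family a) => //; rewrite minn0.
Qed.

Lemma Mset_frequent : (0 < l)%N -> Mset l A = frequent l family.
Proof.
move=> l0; apply/setP => a; rewrite !inE mu_deg mem_Aunion.
by case: leqP l0; lia.
Qed.

Lemma perm_family i j : j != i ->
  perm_eq family [:: A i, A j & [seq A k | k <- rem j (rem i (enum 'I_m))]].
Proof.
by move=> ji; apply/(perm_map A (perm_two_heads _ _ ji)); rewrite mem_enum.
Qed.

Lemma minimizing_parts (s : seq {set 'Z_p}) (d : 'Z_p) : perm_eq family s ->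
  (l <= m)%N -> d != 0 -> all (fun X : {set 'Z_p} => 1 < #|X|)%N (take l s) ->
  sumS (parts l s) = Sigma l A -> (forall B, B \in parts l s -> is_arc d B) -> minimizing l A d.
Proof.
move=> fs lm d0 big sT arcs.
have ls : (l <= size s)%N by rewrite -(perm_size fs) size_family.
have sP := size_parts ls; pose B (j : 'I_l) := nth set0 (parts l s) j.
have BE : [seq B j | j <- enum 'I_l] = parts l s.
  rewrite /B (map_comp (nth set0 (parts l s)) (@nat_of_ord l)) val_enum_ord.
  by rewrite -[RHS](mkseq_nth set0) sP.
have Bin j : B j \in parts l s by apply: mem_nth; rewrite sP.
have Bdeg a : mu l A a = #|[set j : 'I_l | a \in B j]|.
  by rewrite -deg_enum BE deg_parts // mu_deg (perm_deg fs).
exists B; split=> //.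
- move=> j; apply/subsetP => a aB; rewrite mem_Aunion lt0n; apply/eqP => da.
  have := Bdeg a; rewrite mu_deg da minn0 => /esym/eqP; rewrite cards_eq0 => /eqP/setP/(_ j).
  by rewrite !inE aB.
- by move=> j; apply: (allP (parts_big big)).
- by split=> // j; apply: arc_is_AP => //; apply: arcs.
- by rewrite sumset_sumS BE.
Qed.

Lemma card_sumset_minimizing d : minimizing l A d -> (#|Sigma l A| < p)%N ->
  (#|Sigma l A| + l = \sum_(a in Aunion A) mu l A a + 1)%N.
Proof.
case=> B [BA B2 [d0 BAP] Bmu Bsum] lt.
pose s := [seq B j | j <- enum 'I_l].
have sE : sumS s = Sigma l A by rewrite -Bsum sumset_sumS.
have sz : size s = l by rewrite size_map size_enum_ord.
have s0 : all (fun X => X != set0) s.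
  apply: all_big_neq0; apply/allP => _ /mapP[j _ ->]; exact: B2.
have sa : all (is_arc d) s by apply/allP => _ /mapP[j _ ->]; apply/is_AP_arc/BAP.
have lt' : (#|sumS s| < #|('Z_p : finZmodType)|)%N by rewrite sE card_Zp_prime.
have := cauchy_davenport_seq Gp s0 lt'; have [_] := arc_sumS Gp d0 s0 sa.
have -> : total_card s = (\sum_(a in Aunion A) mu l A a)%N.
  rewrite sum_card_deg [RHS]big_mkcond; apply: eq_bigr => a _.
  rewrite /s deg_enum; case: ifP => [/Bmu //|aA].
  by apply: eq_card0 => j; rewrite inE; apply: contraFF aA => /(subsetP (BA j)).
by rewrite sE sz => ub lb; apply/eqP; rewrite eqn_leq ub.
Qed.

Hypotheses (l2 : (2 <= l)%N) (lm : (l < m)%N) (A2 : forall i, (2 <= #|A i|)%N).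
Hypothesis lt : (#|Sigma l A| < (if l == 2%N then p.-1 else p))%N.
Hypothesis tight : (#|Sigma l A| + l = \sum_(a in Aunion A) mu l A a + 1)%N.

Lemma all_big_family (r : seq 'I_m) k : all (fun X : {set 'Z_p} => 1 < #|X|)%N (take k [seq A i | i <- r]).
Proof. by rewrite -map_take; apply/allP => _ /mapP[i _ ->]. Qed.

Lemma extremal_family : extremal l (Sigma l A) family.
Proof.
split; first by rewrite l2 size_family ltnW.
- by rewrite Sigma_Sig.
- by move: lt; rewrite card_Zp_prime //; case: eqP => _; rewrite ?addn0 ?addn1 -?ltn_predRL.
- by rewrite -sum_mu tight.
Qed.

Let M := Mset l A.

Let bigAM i : (1 < #|A i :|: M|)%N.
Proof. exact/(leq_trans (A2 i))/subset_leq_card/subsetUl. Qed.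

Lemma arc_pair i j : j != i -> exists2 d : 'Z_p, d != 0 &
  is_arc d (A i :|: M) /\ minimizing l A d.
Proof.
move=> ji; have fs := perm_family ji.
have ex := extremal_perm fs extremal_family.
have big := all_big_family (i :: j :: rem j (rem i (enum 'I_m))) l.
have [sT [d d0 arcs]] := extremal_parts Gp ex big.
exists d => //; split.
  rewrite /M Mset_frequent ?(ltnW l2) // (eq_frequent l (perm_deg fs)).
  by case: (l) l2 arcs => // l' _ /(_ _ (mem_head _ _)) [].
by apply: minimizing_parts fs (ltnW lm) d0 big sT _ => B /arcs[].
Qed.

Hypothesis l3 : (2 < l)%N.

Let frequentE s : deg family =1 deg s -> frequent l s = M.
Proof. by move=> fs; rewrite -(eq_frequent l fs) -Mset_frequent // ltnW // ltnW. Qed.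

Lemma arc_two i j : j != i -> exists2 d : 'Z_p, d != 0 &
  [/\ minimizing l A d, is_arc d (A i :|: M), is_arc d (A j :|: M)
    & (#|A i :|: M| + 1 < #|('Z_p : finZmodType)|)%N].
Proof.
move=> ji; have fs := perm_family ji.
have ex := extremal_perm fs extremal_family.
have big := all_big_family (i :: j :: rem j (rem i (enum 'I_m))) l.
have [sT _] := extremal_parts Gp ex big.
have [d d0 [arcs]] := extremal_heads Gp l3 ex big.
rewrite (frequentE (perm_deg fs)) => ai aj ci _.
exists d => //; split=> //.
exact: minimizing_parts fs (ltnW lm) d0 big sT arcs.
Qed.

Lemma arc_union_two (d : 'Z_p) i j k : d != 0 -> j != i -> k != i -> k != j ->
  is_arc d (A k :|: M) -> is_arc d (A i :|: A j :|: M).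
Proof.
move=> d0 ji ki kj ak.
pose r := rem k (rem j (rem i (enum 'I_m))).
have fs : perm_eq family [seq A x | x <- [:: i, j, k & r]].
  apply: perm_trans (perm_family ji) _; apply: (perm_map A (s := [:: i, j & _])).
  rewrite !perm_cons perm_to_rem //.
  have := perm_mem (perm_two_heads (s := enum 'I_m) (mem_enum _ i) (mem_enum _ j) ji) k.
  by rewrite mem_enum in_cons (negPf ki) in_cons (negPf kj) => /esym.
have ex := extremal_uncross (extremal_perm fs extremal_family).
have dg a : deg family a = deg (A i :|: A j :: rcons (map A (k :: r)) (A i :&: A j)) a.
  by rewrite deg_uncross; apply: (perm_deg fs).
have big : all (fun X : {set 'Z_p} => 1 < #|X|)%N
    (take l [:: A i :|: A j, A k & rcons (map A r) (A i :&: A j)]).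
  have sr : (l.-2 <= size (map A r))%N.
    by have := perm_size fs; rewrite size_family !size_map /=; clear -lm; lia.
  have l3' := l3; case: (l) l3' sr => [|[|l']] // _ /= sr; rewrite A2 -cats1 takel_cat //.
  by rewrite all_big_family andbT (leq_trans (A2 i)) // subset_leq_card // subsetUl.
have [d' d'0 [_]] := extremal_heads Gp l3 ex big.
rewrite (frequentE dg) => aij ak' _ ck.
exact: (arc_transfer Gp d0 d'0 ak ak').
Qed.

Lemma common_difference : exists d : 'Z_p,
  [/\ minimizing l A d, is_AP (Aunion A) d & forall i, is_AP (A i :|: M) d].
Proof.
have m1 : (1 < m)%N by lia.
pose i0 : 'I_m := Ordinal (ltnW m1); pose i1 : 'I_m := Ordinal m1.
have [d d0 [mind a0 _ c0]] := @arc_two i0 i1 isT.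
have aA i : is_arc d (A i :|: M).
  have [-> //|ii0] := eqVneq i i0.
  have [d' d'0 [_ a0' ai _]] := arc_two ii0.
  exact: (arc_transfer Gp d0 d'0 a0 a0').
exists d; split=> // [|i]; last exact: arc_is_AP.
have aA2 j : is_arc d (A i0 :|: A j :|: M).
  have [->|ji] := eqVneq j i0; first by rewrite setUid.
  have [k [ki kj]] : exists k : 'I_m, k != i0 /\ k != j.
    have m2 : (2 < m)%N by lia.
    have [E|N] := eqVneq j i1; last by exists i1; split=> //; rewrite eq_sym.
    by exists (Ordinal m2); rewrite E.
  exact: arc_union_two (aA k).
have [x xA] : exists x, x \in A i0 by apply/set0Pn; rewrite -card_gt0 ltnW.
have -> : Aunion A = A i0 :|: M :|: \bigcup_j (A i0 :|: A j :|: M).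
  have sA j : A j \subset Aunion A by apply: bigcup_sup.
  have sM : M \subset Aunion A by apply/subsetP => a; rewrite inE => /andP[].
  apply/eqP; rewrite eqEsubset !subUset sA sM /=; apply/andP; split.
    apply/bigcupsP => j _; apply: subset_trans (subsetUr _ _).
    by apply: (bigcup_max j) => //; rewrite setUAC subsetUr.
  by apply/bigcupsP => j _; rewrite !subUset !sA.
apply: arc_is_AP => //.
pose K U := is_arc d (A i0 :|: M :|: U).
apply: (big_rec K) => [|j U _ KU]; rewrite /K; first by rewrite setU0.
rewrite setUCA; apply: (@arcU _ Gp d _ _ x) => //; by rewrite !inE xA.
Qed.

End Family.

Theorem theorem4p2 (p l m : nat) (A : 'I_m -> {set 'Z_p}) :
  prime p -> (2 <= l)%N -> (l < m)%N ->
  (forall i, (2 <= #|A i|)%N) ->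
  (#|Sigma l A| < (if l == 2%N then p.-1 else p))%N ->
  ((#|Sigma l A| + l = \sum_(a in Aunion A) mu l A a + 1)%N
     <-> exists d : 'Z_p, minimizing l A d)
  /\
  ((#|Sigma l A| + l = \sum_(a in Aunion A) mu l A a + 1)%N ->
     (l = 2%N -> forall i, exists d : 'Z_p, d != 0 /\ is_AP (A i :|: Mset l A) d)
     /\
     ((3 <= l)%N -> exists d : 'Z_p,
        [/\ minimizing l A d, is_AP (Aunion A) d
          & forall i, is_AP (A i :|: Mset l A) d])).
Proof.
move=> p_prime l2 lm A2 lt.
have m1 : (1 < m)%N by lia.
have pair tight i := arc_pair p_prime l2 lm A2 lt tight (i := i).
split; first split.
- move=> tight; have [|d _ [_ mind]] := pair tight (Ordinal (ltnW m1)) (Ordinal m1); first by [].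
  by exists d.
- case=> d mind; apply: card_sumset_minimizing mind _ => //.
  by apply: leq_trans lt _; case: ifP => // _; apply: leq_pred.
move=> tight; split=> [_ i|l3]; last exact: common_difference.
have [j ji] : exists j : 'I_m, j != i.
  have [E|N] := eqVneq i (Ordinal m1); last by exists (Ordinal m1); rewrite eq_sym.
  by exists (Ordinal (ltnW m1)); rewrite E.
have [d d0 [ad _]] := pair tight i j ji.
by exists d; split=> //; apply: arc_is_AP.
Qed.
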